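(* Let $\mathcal{H}$ be a complex Hilbert space and let $A\in\mathcal{B}(\mathcal{H})$. Then $$ w(A)\geq\frac{1}{2}\|A\|+\frac{1}{2\sqrt{2}}\,\Big|\,\|\Re(A)+\Im(A)\|-\|\Re(A)-\Im(A)\|\,\Big|. $$
   Context: $\mathcal{B}(\mathcal{H})$ denotes the $C^*$-algebra of bounded linear operators on the complex Hilbert space $\mathcal{H}$, with operator norm $\|\cdot\|$. For $A\in\mathcal{B}(\mathcal{H})$ with adjoint $A^*$: $\Re(A)=\frac{1}{2}(A+A^* )$ and $\Im(A)=\frac{1}{2\mathrm{i}}(A-A^* )$ (self-adjoint operators). The numerical radius is $w(A)=\sup\{|\langle Ax,x\rangle|: x\in\mathcal{H},\ \|x\|=1\}$. *)

(* Defs.v *)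
From HB Require Import structures.
From mathcomp Require Import all_boot all_order all_algebra.
From mathcomp Require Import complex.
From mathcomp Require Import boolp classical_sets functions reals.
From mathcomp Require Import topology normedtype.

Set Implicit Arguments.
Unset Strict Implicit.
Unset Printing Implicit Defensive.

Import Order.TTheory GRing.Theory Num.Theory.
Import numFieldNormedType.Exports.

Local Open Scope classical_set_scope.
Local Open Scope ring_scope.

(* The inner product is linear in its first argument and conjugate-linear in
   its second one. The second field makes the norm, hence the topology and the
   completeness of the space, the one given by the inner product. *)
HB.mixin Record CompleteNormedModule_isHilbert (R : realType) H
    of CompleteNormedModule R[i] H := {
  inner : {dot H for @Num.conj R[i]} ;
  sqr_norm_inner : forall x : H, `|x| ^+ 2 = inner x x
}.

#[short(type="hilbertType")]
HB.structure Definition Hilbert (R : realType) :=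
  { H of CompleteNormedModule R[i] H & CompleteNormedModule_isHilbert R H }.

Arguments inner {R H} : rename.

(* Norms over R[i] take their values in R[i], where they are nonnegative
   reals; rnorm is the same norm with values in R, where suprema exist. *)
Definition rnorm (R : realType) (V : normedZmodType R[i]) (x : V) : R :=
  complex.Re `|x|.

Section Operators.
Variables (R : realType) (H : hilbertType R).
Implicit Types A : H -> H.

(* As sup set0 = 0, opnorm and numerical_radius are 0 on the zero space. *)
Definition opnorm A : R := sup [set rnorm (A x) | x in [set x | `|x| <= 1]].

Definition numerical_radius A : R :=
  sup [set rnorm (inner (A x) x) | x in [set x | `|x| = 1]].

(* If A is linear and bounded, such a z exists by the Riesz representation
   theorem; it is unique in any case. *)
Definition adjoint A : H -> H :=
  fun y => xget 0 [set z | forall x, inner (A x) y = inner x z].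

Definition re_op A : H -> H := 2^-1 *: (A + adjoint A).

Definition im_op A : H -> H := (2 * 'i)^-1 *: (A - adjoint A).

End Operators.

(* Main.v *)
(* With S = Re A + Im A, T = Re A - Im A and c = (1 - i)/2, one has
   S = c A + c^* A^*, T = c^* A + c A^* and A = c^* S + c T; |c| = 1/sqrt 2.
   As S and T are self-adjoint, their norms are the suprema of their quadratic
   forms, whence max (|S|, |T|) <= sqrt 2 w(A); and |A| <= (|S| + |T|)/sqrt 2.
   The claim follows from max (s, t) = (s + t)/2 + |s - t|/2. The existence of
   A^* rests on Riesz representation, obtained by minimizing |x|^2 - 2 Re f(x):
   near-minimizers form a Cauchy filter by the parallelogram identity. *)

Require Import Defs.
From mathcomp Require Import all_boot all_order all_algebra.
From mathcomp Require Import complex ring lra.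
From mathcomp Require Import boolp classical_sets functions reals.
From mathcomp Require Import topology normedtype.

Import Order.TTheory GRing.Theory Num.Theory.
Import numFieldNormedType.Exports.

Local Open Scope classical_set_scope.
Local Open Scope ring_scope.

(** * Real parts and moduli of complex numbers *)

Section ComplexNumbers.
Context {R : realType}.
Implicit Types (z w : R[i]) (t : R).

Lemma ReD z w : complex.Re (z + w) = complex.Re z + complex.Re w.
Proof. by case: z; case: w. Qed.

Lemma ReN z : complex.Re (- z) = - complex.Re z.
Proof. by case: z. Qed.

Lemma ReMr t z : complex.Re (t%:C%C * z) = t * complex.Re z.
Proof. by case: z => a b; rewrite /= mul0r subr0. Qed.

Lemma Re_conj z : complex.Re (Num.conj z) = complex.Re z.
Proof. by case: z. Qed.

Lemma rnorm_real t : rnorm (t%:C%C : R[i]) = `|t|.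
Proof. by rewrite /rnorm normc_def/= expr0n/= addr0 sqrtr_sqr. Qed.

Lemma normr_Re_le z : `|complex.Re z| <= rnorm z.
Proof. by have := normc_ge_Re z; rewrite lecE => /andP[_]. Qed.

Lemma Re_le_rnorm z : complex.Re z <= rnorm z.
Proof. exact: le_trans (ler_norm _) (normr_Re_le z). Qed.

Lemma rnormM z w : rnorm (z * w) = rnorm z * rnorm w.
Proof. by rewrite /rnorm normrM -(RRe_real (normr_real z)) ReMr. Qed.

Lemma sqr_rnormc z : z * Num.conj z = (rnorm z ^+ 2)%:C%C.
Proof. by rewrite -normCK rmorphXn /= /rnorm RRe_real// normr_real. Qed.

End ComplexNumbers.

(** * The real-valued norm *)

Section Norm.
Context {R : realType} {V : normedZmodType R[i]}.
Implicit Types x y : V.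

Lemma rnormE x : (rnorm x)%:C%C = `|x|.
Proof. by rewrite /rnorm RRe_real ?normr_real. Qed.

Lemma rnorm_ge0 x : 0 <= rnorm x.
Proof. by rewrite -lecR rnormE normr_ge0. Qed.

Lemma rnorm_eq0 x : (rnorm x == 0) = (x == 0).
Proof. by rewrite -(inj_eq (@complexI R)) rnormE normr_eq0. Qed.

Lemma ler_rnormD x y : rnorm (x + y) <= rnorm x + rnorm y.
Proof. by rewrite -lecR rmorphD /= !rnormE ler_normD. Qed.

Lemma rnormN x : rnorm (- x) = rnorm x.
Proof. by rewrite /rnorm normrN. Qed.

Lemma norm_le1 x : (`|x| <= 1) = (rnorm x <= 1).
Proof. by rewrite -rnormE -lecR. Qed.

Lemma norm_eq1 x : (`|x| = 1) <-> (rnorm x = 1).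
Proof. by rewrite -rnormE; split=> [/complexI//|->]. Qed.

End Norm.

Lemma rnormZ (R : realType) (V : normedModType R[i]) (a : R[i]) (x : V) :
  rnorm (a *: x) = rnorm a * rnorm x.
Proof. by apply: complexI; rewrite rmorphM /= rnormE normrZ -!rnormE. Qed.

(** * Inner products and the Cauchy-Schwarz inequality *)

Section InnerProduct.
Context {R : realType} {H : hilbertType R}.
Implicit Types x y z : H.

Lemma innerDl x y z : inner (x + y) z = inner x z + inner y z.
Proof. exact: linearDl. Qed.

Lemma innerDr x y z : inner x (y + z) = inner x y + inner x z.
Proof. exact: linearDr. Qed.

Lemma innerZl a x y : inner (a *: x) y = a * inner x y.
Proof. exact: linearZl_LR. Qed.

Lemma innerZr a x y : inner x (a *: y) = Num.conj a * inner x y.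
Proof. exact: linearZr_LR. Qed.

Lemma innerNl x y : inner (- x) y = - inner x y.
Proof. by rewrite -scaleN1r innerZl mulN1r. Qed.

Lemma innerNr x y : inner x (- y) = - inner x y.
Proof. by rewrite -scaleN1r innerZr rmorphN1 mulN1r. Qed.

Lemma inner_conj x y : inner x y = Num.conj (inner y x).
Proof. by rewrite hermC expr0 mul1r. Qed.

(** The underlying real inner product, which turns estimates into real arithmetic. *)
Definition rdot x y := complex.Re (inner x y).

Lemma rdotDl x y z : rdot (x + y) z = rdot x z + rdot y z.
Proof. by rewrite /rdot innerDl ReD. Qed.

Lemma rdotZl (t : R) x y : rdot (t%:C%C *: x) y = t * rdot x y.
Proof. by rewrite /rdot innerZl ReMr. Qed.

Lemma rdotNl x y : rdot (- x) y = - rdot x y.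
Proof. by rewrite /rdot innerNl ReN. Qed.

Lemma rdotC x y : rdot x y = rdot y x.
Proof. by rewrite /rdot inner_conj Re_conj. Qed.

Lemma rdotDr x y z : rdot x (y + z) = rdot x y + rdot x z.
Proof. by rewrite rdotC rdotDl !(rdotC x). Qed.

Lemma rdotNr x y : rdot x (- y) = - rdot x y.
Proof. by rewrite rdotC rdotNl rdotC. Qed.

Lemma rdotZr (t : R) x y : rdot x (t%:C%C *: y) = t * rdot x y.
Proof. by rewrite rdotC rdotZl rdotC. Qed.

Lemma rdotxx x : rdot x x = rnorm x ^+ 2.
Proof. by rewrite /rdot -sqr_norm_inner -rnormE -rmorphXn. Qed.

(** Squaring the triangle inequality and cancelling the squared norms leaves this bound. *)
Lemma rdot_le x y : rdot x y <= rnorm x * rnorm y.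
Proof.
have : rnorm (x + y) ^+ 2 <= (rnorm x + rnorm y) ^+ 2.
  by rewrite lerXn2r ?nnegrE ?addr_ge0 ?rnorm_ge0// ler_rnormD.
rewrite -rdotxx rdotDl !rdotDr (rdotC y) !rdotxx; nra.
Qed.

Lemma rnorm_inner_le x y : rnorm (inner x y) <= rnorm x * rnorm y.
Proof.
set z := inner x y; have [z0|z0] := eqVneq (rnorm z) 0.
  by rewrite z0 mulr_ge0 ?rnorm_ge0.
have sz : rnorm (Num.conj z) = rnorm z by rewrite /rnorm norm_conjC.
(* Multiplying [x] by the conjugate of [z] makes the inner product real, equal to |z|^2; one factor
   |z| then cancels. *)
have := rdot_le (Num.conj z *: x) y.
rewrite /rdot innerZl mulrC sqr_rnormc rnormZ sz /= expr2 -mulrA.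
by rewrite ler_pM2l// lt_def z0 rnorm_ge0.
Qed.

End InnerProduct.

(** * Riesz representation by a variational argument *)

Section Riesz.
Context {R : realType} {H : hilbertType R}.
Variables (f : {scalar H}) (M : R).
Hypothesis f_bounded : forall x, rnorm (f x) <= M * rnorm x.

(** If f = <., z>, then J x = |x - z|^2 - |z|^2, so the minimizer of [J] is the representing
    vector. *)
Let J x : R := rnorm x ^+ 2 - 2 * complex.Re (f x).

Let J_ge x : - M ^+ 2 <= J x.
Proof.
have := le_trans (Re_le_rnorm (f x)) (f_bounded x).
by have := sqr_ge0 (rnorm x - M); rewrite /J; nra.
Qed.

Let J_inf : has_inf (range J).
Proof.
split; first by exists (J 0), 0.
by exists (- M ^+ 2) => _ [x _ <-].
Qed.

Let d := inf (range J).

Let d_le x : d <= J x.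
Proof. by apply: ge_inf; [case: J_inf | exists x]. Qed.

Let near_min (e : R) : set H := [set x | J x < d + e].

Let near_min_nonempty (e : R) : 0 < e -> near_min e !=set0.
Proof.
by move=> e0; have [_ [x _ <-] ?] := inf_adherent e0 J_inf; exists x.
Qed.

Let J_add x v (t : R) :
  J (x + t%:C%C *: v) =
  J x + 2 * t * (rdot v x - complex.Re (f v)) + t ^+ 2 * rnorm v ^+ 2.
Proof.
rewrite /J -!rdotxx !(rdotDl, rdotDr, rdotZl, rdotZr) (rdotC x v).
have -> : f (x + t%:C%C *: v) = f x + t%:C%C * f v.
  by rewrite linearD linearZ.
by rewrite ReD ReMr; ring.
Qed.

Let near_min_dist e x y :
  near_min e x -> near_min e y -> rnorm (x - y) ^+ 2 < 4 * e.
Proof.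
rewrite /near_min /= => xe ye.
set v := x - y.
have Ey : J y = J (x + (-1)%:C%C *: v).
  by rewrite rmorphN1 scaleN1r opprB addrC subrK.
(* At the midpoint of [x] and [y], [J] equals (J x + J y)/2 - |x - y|^2/4, and this is at least
   [d]. *)
have := d_le (x + (- 2^-1)%:C%C *: v).
by move: ye; rewrite Ey !J_add; lra.
Qed.

Let F := filter_from [set e : R | 0 < e] near_min.

#[local] Instance minimizing_filter_proper : ProperFilter F.
Proof.
apply: filter_from_proper => [|e]; last exact: near_min_nonempty.
apply: filter_from_filter; first by exists 1; exact: ltr01.
move=> a b /= a0 b0; exists (Num.min a b); first by rewrite /= lt_min a0.
move=> x; rewrite /near_min /= => /lt_le_trans xab.
by split; apply: xab; rewrite lerD2l ge_min lexx ?orbT.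
Qed.

Let F_cvg : cvg F.
Proof.
apply: cauchy_cvg; apply: cauchy_exP => eps eps0.
have epsE : (complex.Re eps)%:C%C = eps by rewrite RRe_real// gtr0_real.
have r0 : 0 < complex.Re eps by rewrite -ltcR epsE.
have e0 : 0 < complex.Re eps ^+ 2 / 4 by rewrite divr_gt0// exprn_gt0.
have [x xe] := near_min_nonempty _ e0.
exists x, (complex.Re eps ^+ 2 / 4) => // y ye.
rewrite -ball_normE /= -rnormE -epsE ltcR.
have := near_min_dist _ _ _ xe ye; rewrite mulrC divfK ?pnatr_eq0//.
by rewrite ltr_pXn2r// nnegrE ?rnorm_ge0// ltW.
Qed.

Lemma riesz_representation : exists z, forall x, f x = inner x z.
Proof.
(* Real parts suffice: evaluating at i x recovers the imaginary parts. *)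
suff [z Hz] : exists z, forall v, complex.Re (f v) = rdot v z.
  exists z => x; have := Hz x; have := Hz ('i%C *: x).
  rewrite /rdot linearZ innerZl /=.
  case: (f x) (inner x z) => [a b] [a' b'] /=.
  by rewrite !mul0r !mul1r !sub0r => /oppr_inj -> ->.
exists (lim F) => v.
set g := rdot v (lim F) - complex.Re (f v).
(* [g] is half the derivative of [J] at the limit along [v]. Minimality is used at a near-minimizer
   [x] close to the limit: half of [e] pays for near-minimality, half for replacing [x] by the
   limit. *)
have key (t : R) : 0 <= 2 * t * g + t ^+ 2 * rnorm v ^+ 2.
  apply/ler_addgt0Pr => e e0.
  pose r := e / (4 * (`|t| * rnorm v + 1)).
  have p0 : 0 < `|t| * rnorm v + 1 by rewrite ltr_wpDl// mulr_ge0 ?rnorm_ge0.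
  have r0 : 0 < r by rewrite divr_gt0// mulr_gt0.
  have Fr : F (ball (lim F) r%:C%C).
    by apply: F_cvg; apply: nbhsx_ballx; rewrite ltcR.
  have Fe : F (near_min (e / 2)) by exists (e / 2) => //=; rewrite divr_gt0.
  have [x [xr xe]] := filter_ex (filterI Fr Fe).
  move: xr; rewrite -ball_normE /= -rnormE ltcR => xr.
  have := d_le (x + t%:C%C *: v); move: xe; rewrite /near_min /= J_add.
  have : 2 * rdot (t%:C%C *: v) (x - lim F) <= e / 2.
    apply: (@le_trans _ _ (2 * ((`|t| * rnorm v) * r))).
      rewrite ler_pM2l//; apply: le_trans (rdot_le _ _) _.
      rewrite rnormZ rnorm_real ler_wpM2l ?mulr_ge0 ?rnorm_ge0//.
      by rewrite -rnormN opprB ltW.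
    have -> : e / 2 = 2 * ((`|t| * rnorm v + 1) * r).
      by rewrite /r; field; rewrite gt_eqF.
    by rewrite ler_pM2l// ler_pM2r// lerDl.
  by rewrite rdotZl rdotDr rdotNr /g; lra.
suff : g = 0 by move=> /subr0_eq ->.
pose n := rnorm v ^+ 2; have n0 : 0 <= n by rewrite exprn_ge0 ?rnorm_ge0.
(* The optimal t would be -g/n; the denominator n + 1 also covers v = 0 and still gives a negative
   value unless g = 0. *)
have := key (- g / (n + 1)); rewrite -/n.
have -> : 2 * (- g / (n + 1)) * g + (- g / (n + 1)) ^+ 2 * n =
    - (g ^+ 2 * ((n + 2) / (n + 1) ^+ 2)).
  by field; rewrite gt_eqF// ltr_wpDl.
rewrite oppr_ge0 pmulr_lle0 ?divr_gt0 ?exprn_gt0 ?ltr_wpDl//.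
by rewrite le_eqVlt ltNge sqr_ge0 orbF sqrf_eq0 => /eqP.
Qed.

End Riesz.

(** * The adjoint and the numerical radius of a bounded operator *)

Section NumericalRadius.
Context {R : realType} {H : hilbertType R}.
Variable A : {linear H -> H}.
Hypothesis A_bounded : bounded_near A (nbhs (0 : H)).

Let w := numerical_radius A.

Lemma bounded_rnorm : exists2 M, 0 <= M & forall x, rnorm (A x) <= M * rnorm x.
Proof.
have [r r0 Ar] := pinfty_ex_gt0 ((linear_boundedP A).1 A_bounded).
have rE : (complex.Re r)%:C%C = r by rewrite RRe_real// gtr0_real.
exists (complex.Re r) => [|x]; first by rewrite -lecR rE ltW.
by rewrite -lecR rmorphM /= !rnormE rE.
Qed.

(** Riesz representation of the bounded functional x |-> <A x, y> supplies a witness, so [xget] does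
    not fall back on its default 0. *)
Lemma adjointP x y : inner (A x) y = inner x (adjoint A y).
Proof.
have [M M0 AM] := bounded_rnorm.
suff [z Hz] : exists z, forall x, inner (A x) y = inner x z.
  rewrite /adjoint; case: xgetP => [z' _ ->//|/(_ z)]; by case.
apply: (@riesz_representation _ _ (applyr inner y \o A) (M * rnorm y)) => v /=.
rewrite /applyr mulrAC; apply: le_trans (rnorm_inner_le _ _) _.
by rewrite ler_wpM2r ?rnorm_ge0.
Qed.

Lemma numerical_radius_unit x :
  rnorm x = 1 -> rnorm (inner (A x) x) <= w.
Proof.
move=> x1; apply: ub_le_sup; last by exists x => //; apply/norm_eq1.
have [M M0 AM] := bounded_rnorm.
exists M => _ [y /norm_eq1 y1 <-].
have := AM y; have := rnorm_inner_le (A y) y.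
by rewrite y1 !mulr1; exact: le_trans.
Qed.

Lemma numerical_radius_ge0 : 0 <= w.
Proof.
rewrite /w /numerical_radius; set E := image _ _.
(* Without unit vectors (the zero space) the supremum is 0 by convention. *)
have [->|/set0P[_ [x x1 _]]] := eqVneq E set0.
  by rewrite sup0.
have /norm_eq1/numerical_radius_unit := x1.
exact: le_trans (rnorm_ge0 _).
Qed.

Lemma numerical_radius_le x : rnorm (inner (A x) x) <= w * rnorm x ^+ 2.
Proof.
have [->|x0] := eqVneq x 0.
  have r0 (V : normedZmodType R[i]) : rnorm (0 : V) = 0.
    by apply/eqP; rewrite rnorm_eq0.
  by rewrite linear0 !r0 expr0n mulr0.
have n0 : 0 < rnorm x by rewrite lt_def rnorm_ge0 rnorm_eq0 x0.
pose a : R := (rnorm x)^-1.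
have a0 : `|a| = a by rewrite ger0_norm// invr_ge0 ltW.
have := numerical_radius_unit (a%:C%C *: x).
rewrite rnormZ rnorm_real a0 mulVf ?gt_eqF// => /(_ erefl).
have -> : A (a%:C%C *: x) = a%:C%C *: A x by rewrite linearZ.
rewrite innerZl innerZr !rnormM.
have -> : rnorm (Num.conj a%:C%C) = a.
  by rewrite /rnorm norm_conjC -/(rnorm _) rnorm_real.
rewrite rnorm_real a0 mulrA -expr2 /a exprVn.
by rewrite ler_pdivrMl ?exprn_gt0// mulrC.
Qed.

(* [c A + c^* A^*] is twice the real part of [c A], and the norm of a
   self-adjoint operator is controlled by its quadratic form. *)
Lemma rnorm_selfadjoint_le (c : R[i]) x : rnorm x <= 1 ->
  rnorm (c *: A x + Num.conj c *: adjoint A x) <= 2 * rnorm c * w.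
Proof.
move=> x1; set S := (X in rnorm X).
have quad y : `|complex.Re (c * inner (A y) y)| <= rnorm c * w * rnorm y ^+ 2.
  apply: le_trans (normr_Re_le _) _; rewrite rnormM -mulrA.
  by rewrite ler_wpM2l ?rnorm_ge0 ?numerical_radius_le.
(* Polarization: the form Re (c <A u, u>) at x + y minus its value at x - y is 2 [rdot S y]; the
   parallelogram identity sums the two bounds. *)
have polar y : rdot S y <= rnorm c * w * (rnorm x ^+ 2 + rnorm y ^+ 2).
  have -> : rdot S y =
      complex.Re (c * inner (A x) y) + complex.Re (c * inner (A y) x).
    rewrite /rdot /S innerDl !innerZl ReD; congr (_ + _).
    by rewrite inner_conj -adjointP -rmorphM Re_conj.
  have AD u v : A (u + v) = A u + A v by rewrite linearD.
  have AB u v : A (u - v) = A u - A v by rewrite linearB.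
  have := quad (x + y); have := quad (x - y); rewrite !ler_norml.
  rewrite -!rdotxx AB AD !(innerDl, innerDr, rdotDl, rdotDr).
  rewrite !(innerNl, innerNr, rdotNl, rdotNr) !mulrDr !mulrN !ReD !ReN.
  rewrite (rdotC y x).
  by move=> /andP[? ?] /andP[? ?]; lra.
set s := rnorm S; have [s0|s0] := eqVneq s 0.
  by rewrite s0 !mulr_ge0 ?rnorm_ge0 ?numerical_radius_ge0.
have {}s0 : 0 < s by rewrite lt_def s0 rnorm_ge0.
have si0 : 0 <= s^-1 by rewrite invr_ge0 ltW.
(* The unit vector along [S] gives |S| <= |c| w (|x|^2 + 1). *)
have := polar ((s^-1)%:C%C *: S).
rewrite rdotZr rdotxx rnormZ rnorm_real -/s ger0_norm//.
rewrite mulVf ?gt_eqF// expr2 mulKf ?gt_eqF// expr1n => /le_trans; apply.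
rewrite -[leRHS]mulrA [leRHS]mulrC.
apply: ler_wpM2l; first by rewrite mulr_ge0 ?rnorm_ge0 ?numerical_radius_ge0.
by rewrite -[leRHS]/(1 + 1) lerD2r expr_le1 ?rnorm_ge0.
Qed.

End NumericalRadius.

(** * Operator norms of maps bounded on the unit ball *)

Section OperatorNorm.
Context {R : realType} {H : hilbertType R}.
Variables (B : H -> H) (K : R).
Hypothesis B_le : forall x, rnorm x <= 1 -> rnorm (B x) <= K.

Lemma opnorm_le : opnorm B <= K.
Proof.
apply: ge_sup; last by move=> _ [x x1 <-]; apply: B_le; rewrite -norm_le1.
by exists (rnorm (B 0)), 0 => //=; rewrite normr0 ler01.
Qed.

Lemma rnorm_le_opnorm x : rnorm x <= 1 -> rnorm (B x) <= opnorm B.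
Proof.
move=> x1; apply: ub_le_sup; last by exists x => //=; rewrite norm_le1.
by exists K => _ [y y1 <-]; apply: B_le; rewrite -norm_le1.
Qed.

End OperatorNorm.

(** * The lower bound for the numerical radius *)

Theorem theorem2p1 (R : realType) (H : hilbertType R) (A : {linear H -> H})
    (A_bounded : bounded_near A (nbhs (0 : H))) :
  numerical_radius A >=
    1 / 2 * opnorm A +
    1 / (2 * Num.sqrt 2) *
      `| opnorm (re_op A + im_op A) - opnorm (re_op A - im_op A) |.
Proof.
set w := numerical_radius A.
set B := re_op A + im_op A; set C := re_op A - im_op A.
set q : R := Num.sqrt 2.
have q2 : q ^+ 2 = 2 by rewrite sqr_sqrtr.
have q0 : 0 < q by rewrite sqrtr_gt0.
pose c : R[i] := 2^-1 + (2 * 'i)^-1.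
have ii : 'i * 'i = -1 :> R[i] by rewrite -expr2 sqrCi.
have cE : c = 2^-1 * (1 - 'i).
  by rewrite /c invfM invCi mulrBr mulr1 mulrN.
have cjE : Num.conj c = 2^-1 * (1 + 'i).
  by rewrite cE rmorphM rmorphB /= conjCi fmorphV rmorph_nat rmorph1 opprK.
(* This identity cancels the adjoint in c^* B + c C, and |c|^2 = 1/2 makes the coefficient of [A]
   equal to 1. *)
have c2 : Num.conj c ^+ 2 + c ^+ 2 = 0.
  rewrite cjE cE; set i := 'i.
  transitivity (2^-1 * (1 + i * i)); first by field.
  by rewrite ii subrr mulr0.
have cc : Num.conj c * c = 2^-1.
  rewrite cjE cE; set i := 'i.
  transitivity (2^-1 ^+ 2 * (1 - i * i)); first by ring.
  by rewrite ii; field.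
have cn : 2 * rnorm c = q.
  have : rnorm c ^+ 2 = 2^-1.
    by apply: complexI; rewrite -sqr_rnormc mulrC cc fmorphV rmorph_nat.
  have := rnorm_ge0 c; nra.
have cj2 : Num.conj c = 2^-1 - (2 * 'i)^-1.
  by rewrite /c rmorphD /= !fmorphV rmorphM /= conjCi rmorph_nat mulrN invrN.
have BE x : B x = c *: A x + Num.conj c *: adjoint A x.
  rewrite -[B x]/(2^-1 *: (A x + adjoint A x) +
    (2 * 'i)^-1 *: (A x - adjoint A x)).
  by rewrite cj2 scalerDr scalerBr addrACA -scalerDl -scalerBl.
(* The double conjugate gives [C] the shape of [B] with c^* in place of c, so that one bound serves
   both. *)
have CE x : C x = Num.conj c *: A x + Num.conj (Num.conj c) *: adjoint A x.
  rewrite -[C x]/(2^-1 *: (A x + adjoint A x) -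
    (2 * 'i)^-1 *: (A x - adjoint A x)).
  rewrite conjCK cj2 scalerDr scalerBr opprB [X in _ + X = _]addrC addrACA.
  by rewrite -scalerDl -scalerBl.
have B_le x : rnorm x <= 1 -> rnorm (B x) <= q * w.
  by move=> x1; rewrite BE -cn; exact: rnorm_selfadjoint_le.
have cjn : rnorm (Num.conj c) = rnorm c by rewrite /rnorm norm_conjC.
have C_le x : rnorm x <= 1 -> rnorm (C x) <= q * w.
  by move=> x1; rewrite CE -cn -cjn; exact: rnorm_selfadjoint_le.
have AE x : A x = Num.conj c *: B x + c *: C x.
  rewrite BE CE conjCK !scalerDr !scalerA addrACA -!scalerDl -!expr2 c2.
  by rewrite scale0r addr0 [c * _]mulrC cc -[2^-1]mul1r -splitr scale1r.
have A_le : opnorm A <= rnorm c * (opnorm B + opnorm C).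
  apply: opnorm_le => x x1; rewrite AE; apply: le_trans (ler_rnormD _ _) _.
  rewrite !rnormZ cjn mulrDr.
  by rewrite lerD// ler_wpM2l ?rnorm_ge0// (rnorm_le_opnorm _ (q * w)).
have Bw := opnorm_le _ _ B_le; have Cw := opnorm_le _ _ C_le.
have qE : 1 / (2 * q) = q / 4.
  apply: (mulfI (lt0r_neq0 q0)); rewrite [RHS]mulrA -expr2 q2; field.
  by rewrite gt_eqF.
have qw k : k <= q * w -> q * k <= 2 * w.
  by move=> kw; rewrite -q2 expr2 -mulrA ler_pM2l.
have cq : rnorm c = q / 2 by lra.
(* With s = |B| and t = |C|, the left side is at most q/4 (s + t + |s - t|) = q/2 max (s, t), which
   is at most w. *)
have := qw _ Bw; have := qw _ Cw.
by move: A_le; rewrite qE cq; case: ler0P => _; lra.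
Qed.
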